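(* Let $b(n,m)$ denote the number of Arndt compositions of $n$ whose last part equals $m$. Define $t_1(0)=1$, $t_1(1)=0$, $t_1(n)=F_{n-2}$ for $n\ge2$, and $t_2(0)=0$, $t_2(1)=1$, $t_2(n)=F_{n-1}$ for $n\ge 2$, where $F_n$ are the Fibonacci numbers ($F_0=0,F_1=1,F_n=F_{n-1}+F_{n-2}$). Then for all integers $n\ge 1$ and $m\ge 1$, $$b(n,m)=\begin{cases} t_1(n-m), & \text{if } m\leq n <2m,\\ t_1(n-m) + t_2(n-2m), & \text{if } 2m\leq n,\\ 0, & \text{otherwise.} \end{cases}$$
   Context: A composition of $n$ is a finite sequence $(\sigma_1,\dots,\sigma_\ell)$ of positive integers summing to $n$. An Arndt composition is one with $\sigma_{2i-1}>\sigma_{2i}$ for every positive integer $i$ with $2i\le\ell$. The last part of a nonempty composition is $\sigma_\ell$. *)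

(* Defs.v *)
From mathcomp Require Import all_boot.

Set Implicit Arguments.
Unset Strict Implicit.
Unset Printing Implicit Defensive.

Definition is_composition (n : nat) (s : seq nat) : bool :=
  all (fun x => 0 < x) s && (sumn s == n).

(* sigma_i with the usual 1-based indexing; only meaningful for 1 <= i <= size s *)
Definition part (s : seq nat) (i : nat) : nat := nth 0 s i.-1.

Definition is_arndt (s : seq nat) : bool :=
  [forall i : 'I_(size s).+1,
    (0 < i) && (2 * i <= size s) ==> (part s (2 * i - 1) > part s (2 * i))].

(* [last 0 s] is 0 on the empty sequence, so for 0 < m the empty composition
   is never counted *)
Definition is_arndt_last (n m : nat) (s : seq nat) : bool :=
  [&& is_composition n s, is_arndt s & last 0 s == m].

(* Every composition of n has at most n parts, each at most n, so it is
   represented exactly once in the finite type n.-bseq 'I_n.+1: see b_enum *)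
Definition b (n m : nat) : nat :=
  #|[set s : n.-bseq 'I_n.+1 | is_arndt_last n m (map val s)]|.

Fixpoint fib (n : nat) : nat :=
  match n with
  | 0 => 0
  | 1 => 1
  | (n''.+1 as n').+1 => fib n' + fib n''
  end.

Definition t1 (n : nat) : nat :=
  match n with 0 => 1 | 1 => 0 | _ => fib (n - 2) end.

Definition t2 (n : nat) : nat :=
  match n with 0 => 0 | 1 => 1 | _ => fib (n - 1) end.

Lemma is_arndtP (s : seq nat) :
  reflect (forall i, 0 < i -> 2 * i <= size s -> part s (2 * i - 1) > part s (2 * i))
          (is_arndt s).
Proof.
apply: (iffP forallP) => [H i i0 is_ | H i].
  have lt_i : i < (size s).+1.
    by rewrite ltnS (leq_trans _ is_)// mul2n -addnn leq_addr.
  by have /implyP := H (Ordinal lt_i); apply; rewrite /= i0.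
by apply/implyP => /andP[]; apply: H.
Qed.

Lemma composition_bound n s :
  is_composition n s -> (size s <= n) && all (fun x => x < n.+1) s.
Proof.
case/andP=> + /eqP <-; elim: s => //= x s IH /andP[x0 /IH /andP[ss sl]].
rewrite ltnS leq_addr -[(size s).+1]add1n leq_add //=.
by apply: sub_all sl => y; rewrite !ltnS => /leq_trans; apply; apply: leq_addl.
Qed.

Lemma b_enum n m (l : seq (seq nat)) :
  uniq l -> (forall s, (s \in l) = is_arndt_last n m s) -> b n m = size l.
Proof.
move=> ul lE; rewrite /b cardE.
set e := enum _; pose f (s : n.-bseq 'I_n.+1) := map val s.
have fI : injective f by move=> x y /(inj_map val_inj) /val_inj.
rewrite -(size_map f); apply/perm_size/uniq_perm => //.
  by rewrite map_inj_uniq ?enum_uniq.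
move=> s; rewrite lE; apply/mapP/idP => [[x + ->]|Ps].
  by rewrite mem_enum inE.
have /andP[ss sl] : (size s <= n) && all (fun x => x < n.+1) s.
  by apply: composition_bound; case/and3P: Ps.
have ps : size (map (@inord n) s) <= n by rewrite size_map.
have Es : s = f (Bseq ps).
  rewrite /f /= -map_comp -[LHS]map_id; apply/eq_in_map => x xs /=.
  by rewrite inordK //; apply: (allP sl).
by exists (Bseq ps) => //; rewrite mem_enum inE -/(f _) -Es.
Qed.

(* Main.v *)
(** Classify Arndt compositions by the parity of their length: [t1 k] and [t2 k]
    count those of [k] of even and of odd length.  If the length is odd, deleting
    the last part [m] leaves an arbitrary Arndt composition of [n - m] of even
    length.  If it is even, the composition ends in [(a, m)] with [a > m]; deleting
    [m] and replacing [a] by [a - m] gives an arbitrary Arndt composition of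
    [n - 2m] of odd length.  Hence [b n m] is [t1 (n - m) + t2 (n - 2m)], the first
    term only when [m <= n].  Summing the same two bijections over [m] shows that
    the two counts satisfy the recurrences that determine [t1] and [t2]. *)
Require Import Defs.
From mathcomp Require Import all_boot zify.

Set Implicit Arguments.
Unset Strict Implicit.
Unset Printing Implicit Defensive.

Definition has_card (T : eqType) (P : pred T) (c : nat) : Prop :=
  exists l : seq T, [/\ uniq l, l =i P & size l = c].

Section HasCard.

Variables T U : eqType.
Implicit Types (P Q : pred T) (c d n : nat).

Lemma eq_has_card P Q c : P =1 Q -> has_card P c -> has_card Q c.
Proof.
move=> eqPQ [l [l_uniq lP l_size]]; exists l; split=> // x.
by rewrite lP; apply: eqPQ.
Qed.

Lemma has_card0 P : P =1 pred0 -> has_card P 0.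
Proof. by move=> P0; exists [::]; split=> // x; rewrite [RHS]P0. Qed.

Lemma has_card1 (x : T) : has_card (pred1 x) 1.
Proof. by exists [:: x]; split=> // y; rewrite inE. Qed.

Lemma has_cardU P Q c d :
  (forall x, P x -> ~~ Q x) -> has_card P c -> has_card Q d ->
  has_card (predU P Q) (c + d).
Proof.
move=> disjPQ [k [k_uniq kP <-]] [l [l_uniq lQ <-]].
exists (k ++ l); split; last by rewrite size_cat.
  rewrite cat_uniq k_uniq l_uniq andbT; apply/hasPn => x.
  by rewrite kP lQ; apply: contraL => /disjPQ.
by move=> x; rewrite mem_cat kP lQ.
Qed.

Lemma has_card_image (f : T -> U) P (Q : pred U) c :
  {in P &, injective f} -> (forall y, reflect (exists2 x, P x & y = f x) (Q y)) ->
  has_card P c -> has_card Q c.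
Proof.
move=> f_inj imP [l [l_uniq lP <-]]; exists (map f l); rewrite size_map.
split=> // [|y].
  by rewrite map_inj_in_uniq // => x y; rewrite !lP; apply: f_inj.
by apply/mapP/imP => -[x Px ->]; exists x; rewrite // ?lP // -[P x]lP.
Qed.

Lemma has_card_fibers P (g : T -> nat) (c : nat -> nat) n :
  (forall i, i < n -> has_card [pred x | P x & g x == i] (c i)) ->
  has_card [pred x | P x & g x < n] (\sum_(i < n) c i).
Proof.
elim: n => [_|n IHn fibers].
  by rewrite big_ord0; apply: has_card0 => x /=; rewrite andbF.
rewrite big_ord_recr /=.
apply: (eq_has_card (P := predU [pred x | P x & g x < n] [pred x | P x & g x == n])).
  by move=> x /=; rewrite -andb_orr orbC -leq_eqVlt.
apply: has_cardU; [|by apply: IHn => i /ltnW/fibers|exact: fibers].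
by move=> x /= /andP[_ /ltn_eqF->]; rewrite andbF.
Qed.

End HasCard.

Lemma has_card_b n m c : has_card (is_arndt_last n m) c -> b n m = c.
Proof. by case=> l [l_uniq lE <-]; apply: b_enum. Qed.

Lemma is_composition_rcons n s a :
  is_composition n (rcons s a) = (0 < a <= n) && is_composition (n - a) s.
Proof.
by rewrite /is_composition all_rcons sumn_rcons; case: all => /=; lia.
Qed.

Lemma part_rcons s a i : 0 < i <= size s -> part (rcons s a) i = part s i.
Proof. by case: i => // i /= i_lt; rewrite /part nth_rcons i_lt. Qed.

Lemma part_size_rcons s a : part (rcons s a) (size s).+1 = a.
Proof. by rewrite /part nth_rcons ltnn eqxx. Qed.

Lemma part_size s : part s (size s) = last 0 s.
Proof. exact: nth_last. Qed.

Lemma is_arndt_rcons s a :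
  is_arndt (rcons s a) = is_arndt s && (odd (size s) ==> (a < last 0 s)).
Proof.
apply/is_arndtP/andP => [arndt_sa | [/is_arndtP arndt_s lt_last] i i_gt0].
  split; [apply/is_arndtP => i i_gt0 i_le | apply/implyP => odd_s].
    by have := arndt_sa i i_gt0; rewrite size_rcons !part_rcons; [apply|..]; lia.
  have even_size : 2 * (size s)./2.+1 = (size s).+1 by lia.
  have := arndt_sa (size s)./2.+1 isT.
  rewrite size_rcons even_size subn1 part_size_rcons part_rcons ?odd_gt0 //=.
  by rewrite part_size; apply.
rewrite size_rcons leq_eqVlt => /orP[/eqP i_last | i_le].
  have odd_s : odd (size s) by lia.
  rewrite i_last subn1 part_size_rcons part_rcons ?odd_gt0 //= part_size.
  exact: (implyP lt_last).
by rewrite !part_rcons; [apply: arndt_s|..]; lia.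
Qed.

Definition arndt_parity (p : bool) (n : nat) (s : seq nat) : bool :=
  [&& is_composition n s, is_arndt s & odd (size s) == p].

Lemma arndt_parity_nil p n : arndt_parity p n [::] = ~~ p && (n == 0).
Proof.
have arndt0 : is_arndt [::] by apply/is_arndtP => i i_gt0 /=; lia.
rewrite /arndt_parity /is_composition arndt0.
by case: p; rewrite ?andbF //= eq_sym andbT.
Qed.

Lemma arndt_parity_rcons p n s a :
  arndt_parity p n (rcons s a) =
  [&& 0 < a <= n, arndt_parity (~~ p) (n - a) s & p || (a < last 0 s)].
Proof.
rewrite /arndt_parity is_composition_rcons is_arndt_rcons size_rcons /=.
by case: p; case: odd; rewrite ?andbT ?andbF //= -!andbA.
Qed.

Lemma last_arndt_parity_leq p n s : arndt_parity p n s -> last 0 s <= n.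
Proof.
by case/lastP: s => [//|s a]; rewrite arndt_parity_rcons last_rcons => /andP[/andP[]].
Qed.

Definition arndt_parity_last (p : bool) (n m : nat) : pred (seq nat) :=
  [pred s | arndt_parity p n s & last 0 s == m].

Lemma arndt_parity_last0 p n s :
  arndt_parity_last p n 0 s = ~~ p && (n == 0) && (s == [::]).
Proof.
rewrite /arndt_parity_last /=; case/lastP: s => [|s a].
  by rewrite arndt_parity_nil.
rewrite arndt_parity_rcons last_rcons -size_eq0 size_rcons andbF.
by case: posnP => [|]; rewrite ?andbF.
Qed.

Definition add_last (m : nat) (s : seq nat) : seq nat :=
  if s is x :: t then rcons (belast x t) (last x t + m) else [::].

Lemma add_last_rcons m s a : add_last m (rcons s a) = rcons s (a + m).
Proof. by case: s => //= x s; rewrite last_rcons belast_rcons. Qed.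

Lemma add_last_inj m : injective (add_last m).
Proof.
move=> s t; case/lastP: s => [|s a]; case/lastP: t => [|t c];
  rewrite ?add_last_rcons //; [by case: t|by case: s|].
by move=> /rcons_inj[-> /addIn ->].
Qed.

Lemma has_card_arndt_last_odd n m c : 0 < m ->
  has_card (arndt_parity false (n - m)) c ->
  has_card (arndt_parity_last true n m) (if m <= n then c else 0).
Proof.
move=> m_gt0; have [m_le|m_gt] := leqP m n.
  apply: (has_card_image (in2W (rcons_injl m))) => s; apply: (iffP andP) => [[]|[u]].
    case/lastP: s => [|s a]; first by rewrite arndt_parity_nil.
    by rewrite arndt_parity_rcons last_rcons => /and3P[_ arndt_s _] /eqP<-; exists s.
  by move=> arndt_u ->; rewrite arndt_parity_rcons last_rcons arndt_u m_gt0 m_le.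
move=> _; apply: has_card0 => s.
by apply/andP => -[/last_arndt_parity_leq + /eqP last_s]; rewrite last_s leqNgt m_gt.
Qed.

Lemma arndt_parity_rcons_add_last n m s : 0 < m ->
  arndt_parity false n (rcons (add_last m s) m) = arndt_parity true (n - 2 * m) s.
Proof.
move=> m_gt0; case/lastP: s => [|s a].
  by rewrite arndt_parity_rcons arndt_parity_nil ltn0 !andbF.
rewrite add_last_rcons !arndt_parity_rcons last_rcons /=.
rewrite (_ : n - m - (a + m) = n - 2 * m - a); last by lia.
by case: arndt_parity => /=; lia.
Qed.

Lemma has_card_arndt_last_even n m c : 0 < m ->
  has_card (arndt_parity true (n - 2 * m)) c ->
  has_card (arndt_parity_last false n m) c.
Proof.
move=> m_gt0; apply: (has_card_image (f := fun s => rcons (add_last m s) m)).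
  exact: in2W (inj_comp (rcons_injl m) (@add_last_inj m)).
move=> s; apply: (iffP andP) => [[+ /eqP]|[u arndt_u ->]]; last first.
  by rewrite arndt_parity_rcons_add_last // last_rcons.
case/lastP: s => [/= _ m_eq0|s d]; first by rewrite -m_eq0 in m_gt0.
rewrite last_rcons => /[swap] ->; case/lastP: s => [|s a].
  by rewrite arndt_parity_rcons arndt_parity_nil !andbF.
move=> arndt_sam; have m_lt : m < a.
  by move: arndt_sam; rewrite arndt_parity_rcons last_rcons => /and3P[].
have raised : rcons s a = add_last m (rcons s (a - m)).
  by rewrite add_last_rcons subnK // ltnW.
exists (rcons s (a - m)); last by rewrite -raised.
by rewrite -arndt_parity_rcons_add_last // -raised.
Qed.

(* The term before the sum counts the empty sequence, on which [last 0] is 0. *)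
Lemma has_card_arndt_parity_sum_last p n (c : nat -> nat) :
  (forall m, 0 < m <= n -> has_card (arndt_parity_last p n m) (c m)) ->
  has_card (arndt_parity p n) ((~~ p && (n == 0)) + \sum_(1 <= m < n.+1) c m).
Proof.
move=> cardc; pose c0 m := if m is 0 then ~~ p && (n == 0) : nat else c m.
have -> : (~~ p && (n == 0)) + \sum_(1 <= m < n.+1) c m = \sum_(m < n.+1) c0 m.
  rewrite -(big_mkord xpredT c0) [in RHS]big_ltn //; congr (_ + _).
  by apply: eq_big_nat => -[].
apply: eq_has_card (has_card_fibers (P := arndt_parity p n) (g := last 0) _).
  by move=> s /=; case: (boolP (arndt_parity p n s)) => // /last_arndt_parity_leq.
case=> [_|m]; last exact: cardc m.+1.
apply: (eq_has_card (P := [pred s | (~~ p && (n == 0)) && (s == [::])])).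
  by move=> s /=; rewrite -arndt_parity_last0.
by rewrite /c0; case: (~~ p && (n == 0)); [exact: has_card1 | exact: has_card0].
Qed.

Lemma t2S n : t2 n.+1 = t1 n + t2 n.
Proof. by case: n => [|[|[|n]]] //; rewrite /t1 /t2 !subSS !subn0 addnC. Qed.

Lemma t1SS n : 0 < n -> t1 n.+2 = t2 n + t1 n.
Proof. by case: n => [|[|[|n]]] // _; rewrite /t1 /t2 !subSS !subn0. Qed.

Lemma t2_sum_t1 n : t2 n = \sum_(1 <= m < n.+1) t1 (n - m).
Proof.
elim: n => [|n IHn]; first by rewrite big_geq.
by rewrite big_nat_recl // subn1 t2S IHn.
Qed.

Lemma t1_sum_t2 n : t1 n = (n == 0) + \sum_(1 <= m < n.+1) t2 (n - 2 * m).
Proof.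
elim/ltn_ind: n => -[|[|n]] IHn; [by rewrite big_geq | by rewrite big_nat1 |].
have shift m : t2 (n.+2 - 2 * m.+1) = t2 (n - 2 * m) by rewrite mulnS !subSS.
rewrite big_nat_recl // (eq_bigr _ (fun m _ => shift m)) shift muln0 subn0.
case: n IHn {shift} => [_ | n IHn]; first by rewrite big_nat1.
rewrite t1SS // IHn // [in RHS]big_nat_recr // (_ : n.+1 - 2 * n.+2 = 0) /=.
  by rewrite addn0.
by lia.
Qed.

Lemma has_card_arndt_parity n :
  has_card (arndt_parity false n) (t1 n) /\ has_card (arndt_parity true n) (t2 n).
Proof.
elim/ltn_ind: n => n IHn; rewrite t1_sum_t2 t2_sum_t1; split.
  apply: has_card_arndt_parity_sum_last => m /andP[m_gt0 m_le].
  by apply: has_card_arndt_last_even => //; apply: (IHn _ _).2; lia.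
apply: has_card_arndt_parity_sum_last => m /andP[m_gt0 m_le].
have := has_card_arndt_last_odd m_gt0 (IHn (n - m) _).1; rewrite m_le; apply; lia.
Qed.

Lemma b_t1_t2 n m : 0 < m ->
  b n m = (if m <= n then t1 (n - m) else 0) + t2 (n - 2 * m).
Proof.
move=> m_gt0; apply: has_card_b.
have [card_even _] := has_card_arndt_parity (n - m).
have [_ card_odd] := has_card_arndt_parity (n - 2 * m).
have card_last_odd := has_card_arndt_last_odd m_gt0 card_even.
have card_last_even := has_card_arndt_last_even m_gt0 card_odd.
have disjoint s : arndt_parity_last true n m s -> ~~ arndt_parity_last false n m s.
  by rewrite /arndt_parity_last /arndt_parity /=; case: odd; rewrite ?andbF.
apply: eq_has_card (has_cardU disjoint card_last_odd card_last_even) => s.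
rewrite /is_arndt_last /arndt_parity_last /arndt_parity /=.
by case: odd; rewrite ?andbT ?andbF ?orbF ?andbA.
Qed.

Theorem theorem3p2 (n m : nat) (hn : 1 <= n) (hm : 1 <= m) :
  b n m = if m <= n < 2 * m then t1 (n - m)
          else if 2 * m <= n then t1 (n - m) + t2 (n - 2 * m)
          else 0.
Proof.
rewrite b_t1_t2 //.
have [m_le|m_gt] := leqP m n; have [mm_le|mm_gt] := leqP (2 * m) n => //=.
- by have -> : n - 2 * m = 0; [lia | rewrite addn0].
- by lia.
- by have -> : n - 2 * m = 0 by lia.
Qed.
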